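(* Let $H$ be a positive affine semigroup which is minimally generated by $h_1,\ldots,h_n$, and let $L\subset\mathbb{Z}^n$ be the relation lattice of $H$. Let $i\in[n]$ and suppose that $L$ is $i$-separable. Then $T^1(K[H])_{-h_i}\ne0$. In particular, if $K[H]$ is standard graded and $T^1(K[H])_{-1}=0$, then $L$ is inseparable.
   Context: $K$ is a field of characteristic $0$; $[n]=\{1,\ldots,n\}$. An affine semigroup $H\subset\mathbb{Z}^m$ is a finitely generated subsemigroup of $\mathbb{Z}^m$ (containing $0$); it is positive if $0$ is its only invertible element. $\mathbb{Z}H$ is the subgroup generated by $H$. $R=K[H]$ is the $K$-subalgebra of $K[t_1^{\pm1},\ldots,t_m^{\pm1}]$ generated by $t^{h_1},\ldots,t^{h_n}$; $S=K[x_1,\ldots,x_n]$. The relation lattice $L$ is the kernel of $\mathbb{Z}^n\to\mathbb{Z}^m$, $\epsilon_i\mapsto h_i$. $K[H]$ is standard graded if there is a linear form $\ell$ with rational coefficients on $\mathbb{Q}^m$ such that $\ell(h_i)=1$ for all $i$; then $T^1(K[H])_{-1}$ denotes the degree $-1$ component with respect to the induced $\mathbb{Z}$-grading, i.e. the direct sum of the components $T^1(K[H])_a$ with $a\in\mathbb{Z}H$ and $\ell(a)=-1$. Definition of $T^1$: for $v\in\mathbb{Z}^n$ put $f_v=\prod_{v(i)\ge0}x_i^{v(i)}-\prod_{v(i)\le0}x_i^{-v(i)}$, and for $v\in L$ put $h(v)=\sum_{v(i)\ge0}v(i)h_i$. Let $\bigoplus_iR\,dx_i$ be the free graded $R$-module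 with $\deg dx_i=h_i$, and $U$ its submodule generated by $df_v=\sum_iv(i)t^{h(v)-h_i}dx_i$, $v\in L$. With $M^*=\operatorname{Hom}_R(M,R)$, $T^1(R)$ is the cokernel of the restriction map $(\bigoplus_iR\,dx_i)^*\to U^*$; it is $\mathbb{Z}H$-graded and isomorphic to $\operatorname{Ext}^1_R(\Omega_{R/K},R)$. Separability: a lattice (subgroup) $L\subset\mathbb{Z}^n$ is saturated if $\mathbb{Z}^n/L$ is torsionfree; its lattice ideal is $I_L=(f_v: v\in L)$. For $i\in[n]$ let $\pi_i:S[x_{n+1}]\to S$ be the $K$-algebra homomorphism with $\pi_i(x_j)=x_j$ for $j\le n$ and $\pi_i(x_{n+1})=x_i$. A saturated lattice $L\subset\mathbb{Z}^n$ is $i$-separable if there is a saturated lattice $L'\subset\mathbb{Z}^{n+1}$ such that (i) $\operatorname{rank}L'=\operatorname{rank}L$; (ii) $\pi_i(I_{L'})=I_L$; (iii) there exists a minimal system of generators $f_{w_1},\ldots,f_{w_s}$ of $I_{L'}$ such that the vectors $(w_1(n+1),\ldots,w_s(n+1))$ and $(w_1(i),\ldots,w_s(i))$ are linearly independent. $L$ is inseparable if it is not $i$-separable for any $i\in[n]$. *)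

(* Defs.v *)
From HB Require Import structures.
From mathcomp Require Import all_boot all_order all_algebra.
From mathcomp Require Import ring_quotient fraction.
From mathcomp Require Import mpoly.
From mathcomp Require Import boolp.

Set Implicit Arguments.
Unset Strict Implicit.
Unset Printing Implicit Defensive.

Import Order.TTheory GRing.Theory Num.Theory.
Local Open Scope ring_scope.
Local Open Scope quotient_scope.

(* The R-submodule generated by X; for V = A^o this is the ideal generated
   by X in A. *)
Definition generated (R : nzRingType) (V : lmodType R) (X : V -> Prop)
    (v : V) : Prop :=
  exists2 s : seq (R * V), (forall x, x \in s -> X x.2)
    & v = \sum_(x <- s) x.1 *: x.2.

Section Lattices.

Definition saturated n (L : zmodClosed 'rV[int]_n) : Prop :=
  forall (x : Quotient.quot L) (k : nat), (0 < k)%N -> x *+ k = 0 -> x = 0.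

Definition has_rank n (L : zmodClosed 'rV[int]_n) (r : nat) : Prop :=
  exists B : 'M[int]_(r, n),
    injective (fun c : 'rV[int]_r => c *m B) /\
    (forall v, v \in L <-> exists c : 'rV[int]_r, v = c *m B).

Variable K : fieldType.

Definition lattice_binomial n (v : 'rV[int]_n) : {mpoly K[n]} :=
  \prod_(i < n | 0 <= v 0 i) 'X_i ^+ absz (v 0 i)
  - \prod_(i < n | v 0 i <= 0) 'X_i ^+ absz (v 0 i).

Definition lattice_ideal n (L : zmodClosed 'rV[int]_n) :
    {mpoly K[n]} -> Prop :=
  @generated _ {mpoly K[n]}^o (fun f => exists2 v, v \in L & f = lattice_binomial v).

(* The last variable x_{n+1} is 'X_ord_max; x_j for j <= n is
   'X_(lift ord_max j). *)
Definition identify n (i : 'I_n) (q : {mpoly K[n.+1]}) : {mpoly K[n]} :=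
  q \mPo [tuple if unlift ord_max j is Some k then 'X_k else 'X_i | j < n.+1].

Definition min_generators (A : comNzRingType) (I : A -> Prop) s
    (g : 'I_s -> A) : Prop :=
  (forall p, I p <-> @generated A A^o (fun f => exists j, f = g j) p) /\
  forall k, ~ (forall p, I p <->
    @generated A A^o (fun f => exists2 j, j != k & f = g j) p).

(* Meaningful for saturated L; the relation lattices below are saturated, see
   [saturated_rel_lattice]. *)
Definition separable_at n (L : zmodClosed 'rV[int]_n) (i : 'I_n) : Prop :=
  exists L' : zmodClosed 'rV[int]_n.+1,
    [/\ saturated L',
        (exists2 r, has_rank L' r & has_rank L r),
        (forall p, lattice_ideal L p <->
           exists2 q, lattice_ideal L' q & p = identify i q)
      & exists s (w : 'I_s -> 'rV[int]_n.+1),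
          min_generators (lattice_ideal L') (fun j => lattice_binomial (w j)) /\
          row_free (col_mx
            (\row_j ((w j 0 ord_max)%:~R : rat))
            (\row_j ((w j 0 (lift ord_max i))%:~R : rat)))].

Definition inseparable n (L : zmodClosed 'rV[int]_n) : Prop :=
  forall i, ~ separable_at L i.

End Lattices.

Section Semigroup.
Variables (m n : nat) (h : 'I_n -> 'rV[int]_m).

Definition semigroup (P : pred 'I_n) (a : 'rV[int]_m) : Prop :=
  exists c : 'I_n -> nat, a = \sum_(j < n | P j) h j *+ c j.

Definition positive_semigroup : Prop :=
  forall a, semigroup predT a -> semigroup predT (- a) -> a = 0.

Definition minimally_generating : Prop :=
  forall k, ~ (forall a, semigroup predT a <-> semigroup (predC1 k) a).

Definition lincomb (v : 'rV[int]_n) : 'rV[int]_m := \sum_i v 0 i *: h i.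

Definition group_gen (a : 'rV[int]_m) : Prop := exists v, a = lincomb v.

Definition rel_lattice : {pred 'rV[int]_n} := fun v => lincomb v == 0.

Lemma lincombB : {morph lincomb : u v / u - v}.
Proof.
by move=> u v; rewrite /lincomb -sumrB; apply: eq_bigr => i _; rewrite !mxE scalerBl.
Qed.

Fact rel_lattice_zmod : zmod_closed rel_lattice.
Proof.
split; first by rewrite unfold_in /lincomb big1 // => i _; rewrite mxE scale0r.
by move=> u v; rewrite !unfold_in lincombB => /eqP-> /eqP->; rewrite subrr.
Qed.
HB.instance Definition _ :=
  GRing.isZmodClosed.Build _ rel_lattice rel_lattice_zmod.

Lemma saturated_rel_lattice : saturated rel_lattice.
Proof.
move=> x k k0; rewrite -[x]reprK; move: (repr x) => v.
have piM j : \pi_(Quotient.quot rel_lattice) (v *+ j)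
             = (\pi_(Quotient.quot rel_lattice) v : Quotient.quot _) *+ j.
  elim: j => [|j IHj]; first by rewrite !mulr0n [RHS]piE.
  by rewrite !mulrS -IHj [RHS]piE.
have pi0 u : (\pi_(Quotient.quot rel_lattice) u = 0) <-> lincomb u = 0.
  have -> : 0 = \pi_(Quotient.quot rel_lattice) 0 :> Quotient.quot rel_lattice.
    by rewrite [LHS]piE.
  split=> [/eqP|u0]; first by rewrite -Quotient.idealrBE subr0 => /eqP.
  by apply/eqP; rewrite -Quotient.idealrBE subr0; apply/eqP.
rewrite -piM !pi0 => vk0; apply/eqP.
have lincombMn : lincomb (v *+ k) = lincomb v *+ k.
  rewrite /lincomb -sumrMnl; apply: eq_bigr => i _.
  by rewrite mulmxnE -scalerMnl.
move: vk0; rewrite lincombMn => /matrixP vk0; apply/eqP/matrixP => i j.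
move/(_ i j): vk0; rewrite mulmxnE !mxE => /eqP.
by rewrite mulrn_eq0 eqn0Ngt k0 => /eqP.
Qed.

Definition pos_degree (v : 'rV[int]_n) : 'rV[int]_m :=
  \sum_(i < n | 0 <= v 0 i) v 0 i *: h i.

Lemma semigroup_gen i : semigroup predT (h i).
Proof.
exists (fun j => (j == i) : nat).
by rewrite (bigD1 i) //= eqxx mulr1n big1 ?addr0 // => j /negPf->.
Qed.

Lemma pos_degreeN v : lincomb v = 0 -> pos_degree (- v) = pos_degree v.
Proof.
rewrite /lincomb (bigID (fun i => 0 <= v 0 i)) /= => /eqP.
rewrite addr_eq0 => /eqP e; rewrite /pos_degree [RHS]e -sumrN.
rewrite [LHS](bigID (fun i => v 0 i == 0)) /= big1 ?add0r.
  apply: eq_big => [i|i _]; last by rewrite mxE scaleNr.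
  by rewrite mxE oppr_ge0 -ltNge lt_neqAle andbC.
by move=> i /andP[_ /eqP v0]; rewrite mxE v0 oppr0 scale0r.
Qed.

Lemma semigroup_pos_degree v i :
  lincomb v = 0 -> v 0 i != 0 -> semigroup predT (pos_degree v - h i).
Proof.
wlog v0 : v / 0 < v 0 i => [hw L0 vi|L0 _].
  case: (ltrgtP (v 0 i) 0) => vi0; last by rewrite vi0 eqxx in vi.
    rewrite -pos_degreeN //; apply: hw; rewrite ?mxE ?oppr_gt0 ?oppr_eq0 //.
    by rewrite -sub0r lincombB L0 /lincomb big1 ?subr0 // => j _;
       rewrite mxE scale0r.
  exact: hw.
exists (fun j => if 0 <= v 0 j then (absz (v ord0 j) - (j == i))%N else 0%N).
rewrite /pos_degree (bigD1 i) ?ltW //= [RHS](bigD1 i) //= ltW // eqxx.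
rewrite addrAC; congr (_ + _).
  case: (v 0 i) v0 => // -[//|k] _.
  by rewrite subn1 /= -[Posz k.+1]natz scaler_nat mulrSr addrK.
rewrite [LHS]big_mkcondl /=; apply: eq_bigr => j ji.
case: ifP => // vj; first rewrite (negPf ji) subn0.
  by rewrite -scaler_nat natz gez0_abs.
Qed.

End Semigroup.

Section ToricRing.
Variables (K : fieldType) (m n : nat) (h : 'I_n -> 'rV[int]_m).

(* The Laurent polynomial ring K[t_1^{+-1}, ..., t_m^{+-1}] is used as a
   subring of the field K(t_1, ..., t_m); toric_pred is its K-subalgebra
   generated by the t^{h_i}. *)
Local Notation rfrac := {fraction {mpoly K[m]}}.

Definition tmon (a : 'rV[int]_m) : rfrac := \prod_(j < m) tofrac 'X_j ^ a 0 j.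

Definition const_frac : K -> rfrac := @tofrac _ \o @mpolyC m K.

Definition toric_pred : {pred rfrac} := fun x =>
  `[< exists p : {mpoly K[n]}, x = mmap const_frac (fun i => tmon (h i)) p >].

Fact toric_subring : subring_closed toric_pred.
Proof.
split.
- by apply/asboolP; exists 1; rewrite rmorph1.
- move=> x y /asboolP[p ->] /asboolP[q ->].
  by apply/asboolP; exists (p - q); rewrite rmorphB.
- move=> x y /asboolP[p ->] /asboolP[q ->].
  by apply/asboolP; exists (p * q); rewrite rmorphM.
Qed.
HB.instance Definition _ :=
  GRing.isSubringClosed.Build _ toric_pred toric_subring.

Record toric_ring := ToricRing { toric_val : rfrac; _ : toric_val \in toric_pred }.

HB.instance Definition _ := [isSub for toric_val].
HB.instance Definition _ := [Choice of toric_ring by <:].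
HB.instance Definition _ := [SubChoice_isSubComNzRing of toric_ring by <:].

Lemma tmonD a b : tmon (a + b) = tmon a * tmon b.
Proof.
rewrite /tmon -big_split; apply: eq_bigr => j _ /=; rewrite mxE expfzDr //.
rewrite tofrac_eq0; apply/eqP => /(congr1 (mcoeff U_(j)))/eqP.
by rewrite mcoeffX eqxx mcoeff0 oner_eq0.
Qed.

Lemma tmon_toric a : semigroup h predT a -> tmon a \in toric_pred.
Proof.
case=> c ->; apply: (big_ind (fun a => tmon a \in toric_pred)).
- by rewrite /tmon big1 ?rpred1 // => j _; rewrite mxE expr0z.
- by move=> x y *; rewrite tmonD rpredM.
move=> i _; elim: (c i) => [|k IHk]; rewrite ?mulr0n ?mulrS.
  by rewrite /tmon big1 ?rpred1 // => j _; rewrite mxE expr0z.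
rewrite tmonD rpredM //; apply/asboolP; exists 'X_i.
by rewrite mmapX mmap1U.
Qed.

Definition toric_deg (a : 'rV[int]_m) (x : toric_ring) : Prop :=
  exists c : K, val x = const_frac c * tmon a.

(* dx_i, of degree h_i, is the i-th unit vector. *)
Notation freemod := 'rV[toric_ring]_n.

Definition freemod_deg (b : 'rV[int]_m) (u : freemod) : Prop :=
  forall i, toric_deg (b - h i) (u 0 i).

(* For v in L the default value of [insubd] is never used, see
   [diff_binomE]. *)
Definition diff_binom (v : 'rV[int]_n) : freemod :=
  \row_i insubd 0 ((v 0 i)%:~R * tmon (pos_degree h v - h i)).

Lemma diff_binomE v i : v \in rel_lattice h ->
  val (diff_binom v 0 i) = (v 0 i)%:~R * tmon (pos_degree h v - h i).
Proof.
move=> /eqP vL; rewrite mxE insubdK //.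
have [->|vi] := eqVneq (v 0 i) 0; first by rewrite mul0r rpred0.
by apply: rpredM; [exact: rpred_int | exact/tmon_toric/semigroup_pos_degree].
Qed.

Definition diff_pred : {pred freemod} := fun u =>
  `[< generated (fun w => exists2 v, v \in rel_lattice h & w = diff_binom v) u >].

Fact diff_submod : submod_closed diff_pred.
Proof.
split; first by apply/asboolP; exists [::]; rewrite ?big_nil.
move=> a x y /asboolP[s1 s1P ->] /asboolP[s2 s2P ->]; apply/asboolP.
exists ([seq (a * z.1, z.2) | z <- s1] ++ s2).
  move=> z; rewrite mem_cat => /orP[/mapP[t /s1P ? ->] //|/s2P //].
rewrite big_cat big_map scaler_sumr; congr (_ + _).
by apply: eq_bigr => z _; rewrite scalerA.
Qed.
HB.instance Definition _ :=
  GRing.isSubmodClosed.Build _ _ diff_pred diff_submod.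

Record diff_module := DiffModule { diff_val : freemod; _ : diff_val \in diff_pred }.

HB.instance Definition _ := [isSub for diff_val].
HB.instance Definition _ := [Choice of diff_module by <:].
HB.instance Definition _ := [SubChoice_isSubLmodule of diff_module by <:].

End ToricRing.

Section Dual.
Variables (R : comNzRingType) (M : lmodType R).

Definition dual := {linear M -> R^o}.

HB.instance Definition _ := gen_eqMixin dual.
HB.instance Definition _ := gen_choiceMixin dual.

Lemma dualP (f g : dual) : (f : M -> R^o) =1 g -> f = g.
Proof.
case: f g => f [[f1] [f2]] [g [[g1] [g2]]] /= /funext fg; subst g.
by rewrite (Prop_irrelevance f1 g1) (Prop_irrelevance f2 g2).
Qed.

Definition dual0 : dual := \0.
Definition dualN (f : dual) : dual := \- f.
Definition dualD (f g : dual) : dual := f \+ g.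

Fact dualDA : associative dualD.
Proof. by move=> f g k; apply: dualP => x /=; rewrite addrA. Qed.
Fact dualDC : commutative dualD.
Proof. by move=> f g; apply: dualP => x /=; rewrite addrC. Qed.
Fact dual0D : left_id dual0 dualD.
Proof. by move=> f; apply: dualP => x /=; rewrite add0r. Qed.
Fact dualND : left_inverse dual0 dualN dualD.
Proof. by move=> f; apply: dualP => x /=; rewrite addNr. Qed.
HB.instance Definition _ :=
  GRing.isZmodule.Build dual dualDA dualDC dual0D dualND.

End Dual.

Section T1.
Variables (K : fieldType) (m n : nat) (h : 'I_n -> 'rV[int]_m).

Local Notation R := (toric_ring K h).
Local Notation U := (diff_module K h).

Definition restriction (psi : dual 'rV[R]_n) : dual U := psi \o val.

Definition restriction_image : {pred dual U} :=
  fun phi => `[< exists psi, phi = restriction psi >].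

Fact restriction_image_zmod : zmod_closed restriction_image.
Proof.
split; first by apply/asboolP; exists 0; apply: dualP.
move=> f g /asboolP[f' ->] /asboolP[g' ->].
by apply/asboolP; exists (f' - g'); apply: dualP.
Qed.
HB.instance Definition _ :=
  GRing.isZmodClosed.Build _ restriction_image restriction_image_zmod.

Definition T1 := Quotient.quot restriction_image.
HB.instance Definition _ := GRing.Zmodule.on T1.

Definition dual_deg (a : 'rV[int]_m) (phi : dual U) : Prop :=
  forall b u, freemod_deg b (val u) -> toric_deg (a + b) (phi u).

(* T^1(R)_a is the image in the cokernel of the degree a part of the dual of U. *)
Definition T1_deg (a : 'rV[int]_m) (x : T1) : Prop :=
  exists2 phi : dual U, dual_deg a phi & x = \pi_T1 phi.

Definition standard_grading (l : {scalar 'rV[rat]_m}) : Prop :=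
  forall i, l (map_mx intr (h i)) = 1.

Definition T1_total_deg (l : {scalar 'rV[rat]_m}) (d : rat) (x : T1) : Prop :=
  exists2 s : seq T1,
    (forall y, y \in s -> exists a,
       [/\ group_gen h a, l (map_mx intr a) = d & T1_deg a y])
    & x = \sum_(y <- s) y.

End T1.

(* Main.v *)
From HB Require Import structures.
Require Import Defs.
From mathcomp Require Import all_boot all_order all_algebra.
From mathcomp Require Import ring_quotient fraction ssrcomplements mpoly.
From mathcomp Require Import bigenough boolp ring.

Set Implicit Arguments.
Unset Strict Implicit.
Unset Printing Implicit Defensive.

Import Order.TTheory GRing.Theory Num.Theory BigEnough.
Local Open Scope ring_scope.

(* Let p : L' -> L add the last coordinate to the i-th one. As the binomials of
   L' are mapped by pi_i to monomial multiples of binomials f_{p(w)} and generate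
   I_L, p is onto; by equality of ranks it is injective, so there are an integral
   linear form lam and d <> 0 with lam(p(w)) = d w(n+1) on L'. The formula
   phi(u) = sum_k lam_k u_k t^{h_k - h_i} defines a linear form of degree -h_i on
   U; it takes values in R because phi(d pi_i(f_w)) = d w(n+1) t^{deg - h_i}, where
   x_i divides a monomial of pi_i(f_w) as soon as w(n+1) <> 0. If phi extended to
   the free module, comparing coefficients in degree -h_i and using that
   h_k - h_i is not in H for k <> i, one would get d w(n+1) = c (w(i) + w(n+1)) on
   L' for some constant c, against the linear independence in (iii). *)

(** * Sums of coefficients over a class of monomials *)

Section CoefficientSum.
Variables (K : fieldType) (n : nat).
Implicit Types (p q : {mpoly K[n]}) (P : pred 'X_{1..n}) (m : 'X_{1..n}).

(** For P a coset of a lattice or a multidegree, this is the value at (1, ..., 1) of the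
    corresponding graded component of p. *)
Definition coefsum P p : K := \sum_(m <- msupp p | P m) p@_m.

Lemma coefsumE P p k : (msize p <= k)%N ->
  coefsum P p = \sum_(m : 'X_{1..n < k} | P m) p@_m.
Proof.
move=> pk; pose I : subFinType _ := 'X_{1..n < k}.
rewrite /coefsum big_mkcond (big_mksub I) ?msupp_uniq //=; last first.
  by move=> x /msize_mdeg_lt /leq_trans; apply.
rewrite big_rmcond /= => [|m /memN_msupp_eq0 ->]; last by rewrite if_same.
by rewrite [RHS]big_mkcond.
Qed.

Fact coefsum_is_linear P : linear_for *%R (coefsum P).
Proof.
move=> c p q; pose_big_enough k.
  rewrite !(coefsumE P (k := k)) // mulr_sumr -big_split.
  by apply: eq_bigr => m _; rewrite mcoeffD mcoeffZ.
by close.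
Qed.
HB.instance Definition _ P := GRing.isLinear.Build K {mpoly K[n]} K *%R
  (coefsum P) (coefsum_is_linear P).

Lemma coefsumX P m : coefsum P 'X_[m] = (P m)%:R.
Proof.
rewrite /coefsum msuppX big_mkcond big_seq1 mcoeffX eqxx /=.
by case: (P m).
Qed.

Lemma coefsumMX P p a :
  coefsum P (p * 'X_[a]) = coefsum (fun m => P (m + a)%MM) p.
Proof.
rewrite {1}[p]mpolyE mulr_suml linear_sum [RHS]/coefsum [RHS]big_mkcond /=.
apply: eq_bigr => m _; rewrite -scalerAl -mpolyXD linearZ /= coefsumX.
by case: (P _); rewrite ?mulr1 ?mulr0.
Qed.

End CoefficientSum.

(** * Exponent vectors and congruences between monomials *)

Section Exponents.
Variable n : nat.
Implicit Types (a b : 'X_{1..n}) (v : 'rV[int]_n).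

Definition zexp a : 'rV[int]_n := \row_j (a j)%:Z.

Definition pos_part v : 'X_{1..n} :=
  [multinom (if (0 <= v 0 j)%R then absz (v 0%R j) else 0%N) | j < n].

Lemma zexpD a b : zexp (a + b)%MM = zexp a + zexp b.
Proof. by apply/rowP => j; rewrite !mxE mnmDE PoszD. Qed.

Lemma zexp_inj : injective zexp.
Proof. by move=> a b /rowP e; apply/mnmP => j; have:= e j; rewrite !mxE => -[]. Qed.

Lemma pos_part_ge0 v : (forall j, 0 <= v 0 j) -> zexp (pos_part v) = v.
Proof. by move=> v0; apply/rowP => j; rewrite mxE mnmE v0 gez0_abs. Qed.

Lemma pos_partB v : zexp (pos_part v) - zexp (pos_part (- v)) = v.
Proof.
apply/rowP => j; rewrite !mxE !mnmE mxE oppr_ge0 abszN.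
by case: (ltrgtP (v 0 j) 0) => [/ltz0_abs->|/gtz0_abs->|->]; rewrite ?sub0r ?subr0 ?opprK.
Qed.

Lemma lattice_binomialE (K : fieldType) v :
  lattice_binomial K v = 'X_[pos_part v] - 'X_[pos_part (- v)].
Proof.
rewrite /lattice_binomial !mpolyXE_id; congr (_ - _).
  by rewrite big_mkcond; apply: eq_bigr => j _; rewrite mnmE; case: ifP.
rewrite big_mkcond; apply: eq_bigr => j _; rewrite mnmE mxE oppr_ge0 abszN.
by case: ifP.
Qed.

End Exponents.

(* Sums of the coefficients over a coset of G separate monomials that are not
   congruent modulo G. *)
Lemma generated_binomial (K : fieldType) n (G : 'rV[int]_n -> Prop)
    (X : {mpoly K[n]} -> Prop) (a b : 'X_{1..n}) :
  G 0 -> (forall u v, G u -> G v -> G (u - v)) ->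
  (forall f, X f -> exists a' b', G (zexp a' - zexp b') /\ f = 'X_[a'] - 'X_[b']) ->
  @generated _ {mpoly K[n]}^o X ('X_[a] - 'X_[b]) -> G (zexp a - zexp b).
Proof.
move=> G0 GB XG [s sX e].
have GN u : G u -> G (- u) by rewrite -sub0r; apply: GB.
have GD u v : G u -> G v -> G (u + v) by rewrite -[v in u + v]opprK => ? /GN; apply: GB.
pose P m := `[< G (zexp a - zexp m) >].
have : coefsum P ('X_[a] - 'X_[b] : {mpoly K[n]}) = 0.
  have -> : 'X_[a] - 'X_[b] = \sum_(x <- s) x.1 * x.2 :> {mpoly K[n]} by [].
  rewrite linear_sum big1_seq //= => x /sX /XG [a' [b' [Gab ->]]].
  (* As a' and b' are congruent modulo G, m + a' and m + b' satisfy P together, so every multiple of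
     the binomial has coefficient sum 0. *)
  rewrite mulrBr linearB /= !coefsumMX; apply/eqP; rewrite subr_eq0.
  apply/eqP; apply: eq_bigl => m; rewrite /P !zexpD.
  apply/asboolP/asboolP => Gm.
    by move: (GD _ _ Gm Gab); congr G; rewrite !opprD !addrA subrK.
  move: (GB _ _ Gm Gab); congr G.
  by rewrite !opprD opprK !addrA [_ - zexp a' + _]addrAC subrK.
rewrite linearB /= !coefsumX {1}/P subrr.
move: (asboolT G0) => ->.
case: (asboolP (G (zexp a - zexp b))) => // nG /eqP.
by rewrite /P (asboolF nG) subr0 oner_eq0.
Qed.


Lemma generated_mem (R : nzRingType) (V : lmodType R) (X : V -> Prop) v :
  X v -> generated X v.
Proof.
move=> Xv; exists [:: (1, v)]; last by rewrite big_seq1 scale1r.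
by move=> x; rewrite inE => /eqP->.
Qed.

(** * Clearing denominators *)

Lemma clear_denominators p q (A : 'M[rat]_(p, q)) :
  exists2 d : int, d != 0 & exists A' : 'M[int]_(p, q), d%:~R *: A = map_mx intr A'.
Proof.
exists (\prod_(x : 'I_p * 'I_q) denq (A x.1 x.2)).
  by apply/prodf_neq0 => x _; apply: denq_neq0.
exists (\matrix_(i, j) (numq (A i j) * \prod_(x | x != (i, j)) denq (A x.1 x.2))).
apply/matrixP => i j; rewrite !mxE (bigD1 (i, j)) //= !rmorphM /= numqE.
by rewrite mulrC mulrA.
Qed.

Lemma map_intr_mx_inj p q :
  injective (map_mx intr : 'M[int]_(p, q) -> 'M[rat]_(p, q)).
Proof.
move=> A B /matrixP AB; apply/matrixP => i j; move: (AB i j).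
by rewrite !mxE => /intr_inj.
Qed.

(** A rational relation between the rows becomes integral after clearing denominators. *)
Lemma row_free_intr r n (B : 'M[int]_(r, n)) :
  injective (fun c : 'rV[int]_r => c *m B) -> row_free (map_mx intr B : 'M[rat]_(r, n)).
Proof.
move=> injB; apply: inj_row_free => v vB.
have [d d0 [v' e]] := clear_denominators v.
have : v' = 0.
  apply: injB; apply: map_intr_mx_inj.
  by rewrite mul0mx map_mxM -e -scalemxAl vB scaler0 map_mx0.
move=> v'0; move: e; rewrite v'0 map_mx0 => /eqP.
by rewrite scaler_eq0 intr_eq0 (negPf d0) => /eqP.
Qed.

(** * The identification of two variables and its effect on exponents *)

Section Identification.
Variables (n : nat) (i : 'I_n).

(** The map p on row vectors: row j is the unit vector of the variable to which pi_i sends x_j. *)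
Definition identify_mx : 'M[int]_(n.+1, n) :=
  \matrix_(j, k) (odflt i (unlift ord_max j) == k)%:R.

Definition identify_mnm (a : 'X_{1..n.+1}) : 'X_{1..n} :=
  [multinom (a (lift ord_max k) + (i == k) * a ord_max)%N | k < n].

Lemma identify_mxE (w : 'rV[int]_n.+1) k :
  (w *m identify_mx) 0 k = w 0 (lift ord_max k) + (i == k)%:R * w 0 ord_max.
Proof.
rewrite mxE (bigD1_ord ord_max) //= mxE unlift_none /= addrC mulrC.
rewrite (bigD1 k) //= mxE liftK /= eqxx mulr1 big1 ?addr0 // => j jk.
by rewrite mxE liftK /= (negPf jk) mulr0.
Qed.

Lemma zexp_identify a : zexp (identify_mnm a) = zexp a *m identify_mx.
Proof.
by apply/rowP => k; rewrite identify_mxE !mxE mnmE PoszD PoszM; case: (i == k).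
Qed.

Variable K : fieldType.

Fact identify_is_zmod_morphism : zmod_morphism (@identify K n i).
Proof. by move=> p q; rewrite /identify rmorphB. Qed.
Fact identify_is_monoid_morphism : monoid_morphism (@identify K n i).
Proof. by split=> [|p q]; rewrite /identify ?rmorph1 ?rmorphM. Qed.
HB.instance Definition _ := GRing.isZmodMorphism.Build _ _ (@identify K n i)
  identify_is_zmod_morphism.
HB.instance Definition _ := GRing.isMonoidMorphism.Build _ _ (@identify K n i)
  identify_is_monoid_morphism.

Lemma identifyX a : identify i 'X_[a] = 'X_[identify_mnm a] :> {mpoly K[n]}.
Proof.
rewrite /identify comp_mpolyX (bigD1_ord ord_max) //= tnth_mktuple unlift_none.
rewrite (mpolyXE_id _ (identify_mnm a)) mulrC.
rewrite [RHS](eq_bigr (fun k =>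
    'X_k ^+ a (lift ord_max k) * 'X_k ^+ ((i == k) * a ord_max))).
  2: by move=> k _; rewrite mnmE exprD.
rewrite big_split /=; congr (_ * _).
  by apply: eq_bigr => k _; rewrite tnth_mktuple liftK.
rewrite (bigD1 i) //= eqxx mul1n big1 ?mulr1 // => k.
by rewrite eq_sym => /negPf->; rewrite expr0.
Qed.

Lemma identify_binomial w : identify i (lattice_binomial K w) =
  'X_[identify_mnm (pos_part w)] - 'X_[identify_mnm (pos_part (- w))].
Proof. by rewrite lattice_binomialE rmorphB /= !identifyX. Qed.

Lemma identify_pos_partB w :
  zexp (identify_mnm (pos_part w)) - zexp (identify_mnm (pos_part (- w)))
  = w *m identify_mx.
Proof. by rewrite !zexp_identify -mulmxBl pos_partB. Qed.

End Identification.

(** * Comparison of the lattices L' and L *)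

Section SeparatedLattice.
Variables (K : fieldType) (n : nat) (i : 'I_n).
Variables (L : zmodClosed 'rV[int]_n) (L' : zmodClosed 'rV[int]_n.+1).
Hypothesis idL : forall p : {mpoly K[n]}, lattice_ideal L p <->
  exists2 q, lattice_ideal L' q & p = identify i q.

Lemma lattice_ideal_binomial k (M : zmodClosed 'rV[int]_k) (a b : 'X_{1..k}) :
  lattice_ideal M ('X_[a] - 'X_[b] : {mpoly K[k]}) -> zexp a - zexp b \in M.
Proof.
apply: (generated_binomial (G := fun v => v \in M)) => [|u v|f [v vM ->]].
- exact: rpred0.
- exact: rpredB.
exists (pos_part v), (pos_part (- v)).
by rewrite pos_partB lattice_binomialE.
Qed.

Lemma lattice_binomial_ideal k (M : zmodClosed 'rV[int]_k) w :
  lattice_ideal M (lattice_binomial K w) -> w \in M.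
Proof. by rewrite lattice_binomialE => /lattice_ideal_binomial; rewrite pos_partB. Qed.

(** The two exponents of pi_i(f_w) differ by p(w), and this binomial lies in I_L. *)
Lemma identify_mx_lattice w : w \in L' -> w *m identify_mx i \in L.
Proof.
move=> wL'; have : lattice_ideal L (identify i (lattice_binomial K w)).
  by apply/idL; eexists; last by []; apply: generated_mem; exists w.
by rewrite identify_binomial => /lattice_ideal_binomial; rewrite identify_pos_partB.
Qed.

Lemma lattice_ideal_identify p : lattice_ideal L p ->
  @generated _ {mpoly K[n]}^o
    (fun f => exists2 w, w \in L' & f = identify i (lattice_binomial K w)) p.
Proof.
case/idL => q [s sL' e] ->.
have -> : q = \sum_(x <- s) x.1 * x.2 by [].
exists [seq (identify i x.1, identify i x.2 : {mpoly K[n]}^o) | x <- s].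
  by move=> _ /mapP[y /sL' [w wL' ->] ->]; exists w.
by rewrite rmorph_sum big_map; apply: eq_bigr => x _; rewrite rmorphM.
Qed.

(** I_L is generated by the pi_i(f_w), whose exponents are congruent modulo p(L');
    [generated_binomial] is applied with p(L') as G. *)
Lemma identify_mx_onto v : v \in L -> exists2 w, w \in L' & v = w *m identify_mx i.
Proof.
move=> vL; have : lattice_ideal L (lattice_binomial K v).
  by apply: generated_mem; exists v.
move=> /lattice_ideal_identify; rewrite lattice_binomialE => e.
rewrite -[v]pos_partB; move: e; apply: (generated_binomial
  (G := fun v => exists2 w, w \in L' & v = w *m identify_mx i)).
- by exists 0; rewrite ?rpred0 ?mul0mx.
- by move=> _ _ [u uL' ->] [w wL' ->]; exists (u - w); rewrite ?rpredB ?mulmxBl.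
move=> f [w wL' ->].
exists (identify_mnm i (pos_part w)), (identify_mnm i (pos_part (- w))).
by rewrite identify_binomial identify_pos_partB; split=> //; exists w.
Qed.

(* Equality of the ranks makes the surjection L' -> L injective over the
   rationals, so that w |-> w_(n+1) factors through it up to a denominator. *)
Lemma separating_functional r : has_rank L' r -> has_rank L r ->
  exists (lam : 'cV[int]_n) (d : int), d != 0 /\
    forall w, w \in L' -> (w *m identify_mx i *m lam) 0 0 = d * w 0 ord_max.
Proof.
case=> B' [_ L'B'] [B [/row_free_intr freeB LB]].
pose A := B' *m identify_mx i.
(* The rows of A are the images of a basis of L'. As p is onto, they generate the rows of B, which
   forces A to have rank r. *)
have [C BC] : exists C, B = C *m A.
  have rowB k : exists c, row k B == c *m A.
    have : row k B \in L by apply/LB; exists (delta_mx 0 k); rewrite rowE.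
    by case/identify_mx_onto=> w /L'B' [c ->] ->; exists c; rewrite /A mulmxA.
  exists (\matrix_k xchoose (rowB k)).
  by apply/row_matrixP => k; rewrite row_mul rowK; apply/eqP/(xchooseP (rowB k)).
have freeA : row_free (map_mx intr A : 'M[rat]_(r, n)).
  rewrite -row_leq_rank; apply: leq_trans (mxrankM_maxr (map_mx intr C) _).
  by rewrite -map_mxM -BC row_leq_rank.
(* The rows of A being independent, [pinvmx] gives a right inverse, so A x is the last column of
   B'. *)
pose x : 'cV[rat]_n := pinvmx (map_mx intr A) *m map_mx intr (col ord_max B').
have [d d0 [lam dx]] := clear_denominators x.
exists lam, d; split=> // w /L'B' [c ->]; apply: (intr_inj (R := rat)).
have Alam : A *m lam = d *: col ord_max B'.
  apply: map_intr_mx_inj.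
  by rewrite map_mxM -dx -scalemxAr mulmxA mulmxVp // mul1mx map_mxZ.
congr intr; rewrite -!mulmxA [B' *m _]mulmxA -/A Alam -scalemxAr colE mulmxA -colE.
by rewrite !mxE.
Qed.

End SeparatedLattice.


(** * Laurent monomials in the fraction field *)

Section LaurentMonomials.
Variables (K : fieldType) (m : nat).
Implicit Types a b : 'rV[int]_m.

HB.instance Definition _ := GRing.RMorphism.on (@const_frac K m).

Lemma tmon0 : tmon K (0 : 'rV[int]_m) = 1.
Proof. by rewrite /tmon big1 // => j _; rewrite mxE expr0z. Qed.

Lemma tmonMn a k : tmon K (a *+ k) = tmon K a ^+ k.
Proof. by elim: k => [|k IHk]; rewrite ?tmon0 // mulrS exprS tmonD IHk. Qed.

Lemma tmonK a : tmon K (- a) * tmon K a = 1.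
Proof. by rewrite -tmonD addNr tmon0. Qed.

Lemma tmon_neq0 a : tmon K a != 0.
Proof.
by apply/eqP => a0; have /eqP := tmonK a; rewrite a0 mulr0 eq_sym oner_eq0.
Qed.

Lemma tmon_zexp (a : 'X_{1..m}) : tmon K (zexp a) = tofrac 'X_[a].
Proof.
rewrite mpolyXE_id rmorph_prod; apply: eq_bigr => j _ /=.
by rewrite mxE rmorphXn.
Qed.

End LaurentMonomials.

(** * The presentation of K[H], its kernel, and derivations *)

Section ToricEvaluation.
Variables (K : fieldType) (m n : nat) (h : 'I_n -> 'rV[int]_m).
Implicit Types (p q : {mpoly K[n]}) (a b : 'X_{1..n}).

HB.instance Definition _ :=
  GRing.isZmodMorphism.Build _ _ (lincomb h) (lincombB h).

Definition toric_eval : {mpoly K[n]} -> {fraction {mpoly K[m]}} :=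
  mmap (const_frac m) (fun i => tmon K (h i)).
HB.instance Definition _ := GRing.RMorphism.on toric_eval.

Lemma toric_evalZ c p : toric_eval (c *: p) = const_frac m c * toric_eval p.
Proof. exact: mmapZ. Qed.

Lemma toric_evalX a : toric_eval 'X_[a] = tmon K (lincomb h (zexp a)).
Proof.
rewrite [LHS]mmapX /mmap1 /lincomb.
rewrite (big_morph (@tmon K m) (@tmonD K m) (@tmon0 K m)).
by apply: eq_bigr => j _; rewrite mxE -tmonMn -scaler_nat natz.
Qed.

Lemma toric_eval_toric p : toric_eval p \in toric_pred h.
Proof. by apply/asboolP; exists p. Qed.

(** Laurent monomials of distinct degrees are linearly independent. To see this in the fraction
    field, everything is multiplied by a monomial t^N that clears the negative exponents, and
    coefficients of polynomials are compared. *)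
Lemma toric_eval_eq0 p d : toric_eval p = 0 ->
  coefsum (fun a => lincomb h (zexp a) == d) p = 0.
Proof.
move=> p0; set P := fun a => _.
(* A monomial a0 of degree d tells which coefficient to compare; without one the sum is empty. *)
have [/hasP[a0 a0p /eqP da0]|/hasPn nP] := boolP (has P (msupp p)); last first.
  by rewrite /coefsum big1_seq // => a /andP[Pa /nP]; rewrite Pa.
pose N : 'X_{1..m} :=
  [multinom (\sum_(a <- msupp p) absz (lincomb h (zexp a) 0%R j))%N | j < m].
pose e a := pos_part (lincomb h (zexp a) + zexp N).
have eE a : a \in msupp p -> zexp (e a) = lincomb h (zexp a) + zexp N.
  move=> ap; apply: pos_part_ge0 => j; rewrite !mxE mnmE (big_rem a) //=.
  by rewrite PoszD addrA addr_ge0 // -lerBlDl sub0r -abszN lez_abs.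
have : \sum_(a <- msupp p) p@_a *: 'X_[e a] = 0 :> {mpoly K[m]}.
  apply/eqP; rewrite -tofrac_eq0; apply/eqP; rewrite -(mulr0 (tmon K (zexp N))) -p0.
  rewrite /toric_eval /mmap rmorph_sum mulr_sumr /= big_seq [RHS]big_seq.
  apply: eq_bigr => a ap; rewrite -mul_mpolyC rmorphM /= mulrCA; congr (_ * _).
  by rewrite -tmon_zexp eE // addrC tmonD -toric_evalX [toric_eval _]mmapX.
move/(congr1 (mcoeff (e a0))); rewrite raddf_sum mcoeff0 => <- /=.
rewrite /coefsum big_mkcond /= big_seq [RHS]big_seq; apply: eq_bigr => a ap.
rewrite mcoeffZ mcoeffX -(inj_eq (@zexp_inj m)) !eE // (inj_eq (addIr _)) da0 /P.
by case: eqP; rewrite ?mulr1 ?mulr0.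
Qed.

Section Derivation.
Variable lam : 'cV[int]_n.

(** The derivation x^a -> (a . lam) x^a followed by evaluation. Its value at f_v is t^{h_i} times
    phi(df_v), so that phi can be studied on polynomials. *)
Definition toric_deriv p :=
  \sum_k (lam k 0)%:~R * toric_eval ('X_k * p^`M(k)).

Fact toric_deriv_zmod : zmod_morphism toric_deriv.
Proof.
move=> p q; rewrite -sumrB; apply: eq_bigr => k _.
by rewrite mderivB mulrBr rmorphB mulrBr.
Qed.
HB.instance Definition _ := GRing.isZmodMorphism.Build _ _ toric_deriv toric_deriv_zmod.

Lemma toric_derivM p q :
  toric_deriv (p * q) = toric_eval p * toric_deriv q + toric_eval q * toric_deriv p.
Proof.
rewrite !mulr_sumr -big_split; apply: eq_bigr => k _ /=.
by rewrite mderivM !rmorphM rmorphD !rmorphM /=; ring.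
Qed.

Lemma toric_derivX a :
  toric_deriv 'X_[a] = ((zexp a *m lam) 0 0)%:~R * tmon K (lincomb h (zexp a)).
Proof.
rewrite mxE rmorph_sum mulr_suml; apply: eq_bigr => k _ /=.
rewrite mderivX -scalerAr toric_evalZ -toric_evalX mxE intrM [_%:~R * _%:~R]mulrC -mulrA.
rewrite [const_frac _ _]rmorph_nat; congr (_ * _).
have [->|ak] := posnP (a k); first by rewrite !mul0r.
by rewrite -mpolyXD addmC submK // lep1mP -lt0n.
Qed.

Lemma toric_deriv_binomial a b : lincomb h (zexp a) = lincomb h (zexp b) ->
  toric_deriv ('X_[a] - 'X_[b]) =
  (((zexp a - zexp b) *m lam) 0 0)%:~R * tmon K (lincomb h (zexp a)).
Proof.
move=> ab; rewrite raddfB /= !toric_derivX -ab -mulrBl -rmorphB.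
by rewrite mulmxBl [in RHS]mxE [X in _ = (_ + X)%:~R * _]mxE.
Qed.

End Derivation.

End ToricEvaluation.


(** * Linear independence in characteristic 0 *)

Lemma intr_eq0_pchar0 (F : fieldType) (z : int) : [pchar F] =i pred0 ->
  (z%:~R == 0 :> F) = (z == 0).
Proof.
by move=> /pcharf0P F0; case: z => k; rewrite ?NegzE ?rmorphN ?oppr_eq0 /= F0.
Qed.

(** Rational independence yields a nonzero integral 2x2 minor; it stays nonzero in F, and Cramer's
    rule applies. *)
Lemma row_free_pair s (a b : 'rV[int]_s) (F : fieldType) (x y : F) :
  [pchar F] =i pred0 ->
  row_free (col_mx (map_mx intr a) (map_mx intr b) : 'M[rat]_(1 + 1, s)) ->
  (forall j, x * (a 0 j)%:~R + y * (b 0 j)%:~R = 0) -> x = 0 /\ y = 0.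
Proof.
move=> charF freeab xy.
have free0 c d : (forall j, c * a 0 j + d * b 0 j = 0) -> c = 0 /\ d = 0.
  move=> cd.
  have e : row_mx (c%:~R%:M) (d%:~R%:M) *m col_mx (map_mx intr a) (map_mx intr b)
      = (0 : 'rV_(1 + 1)) *m col_mx (map_mx intr a) (map_mx intr b) :> 'rV[rat]_s.
    rewrite mul0mx mul_row_col !mul_scalar_mx; apply/rowP => j.
    by rewrite !mxE -!intrM -intrD cd.
  have := row_free_inj freeab e; rewrite -row_mx0.
  move=> /eq_row_mx[/matrixP/(_ 0 0) + /matrixP/(_ 0 0)].
  by rewrite !mxE eqxx !mulr1n => /eqP + /eqP; rewrite !intr_eq0 => /eqP-> /eqP->.
have [[j k] minor] : exists jk, a 0 jk.1 * b 0 jk.2 - a 0 jk.2 * b 0 jk.1 != 0.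
  apply/existsP; apply: contraT => /existsPn ab0.
  (* If all minors vanish, b_j a - a_j b = 0 for every j; independence gives a = 0, and then 1 a + 0
     b = 0 is a contradiction. *)
  have abC j k : b 0 j * a 0 k - a 0 j * b 0 k = 0.
    by have := ab0 (k, j); rewrite negbK /= => /eqP; rewrite mulrC.
  have a0 j : a 0 j = 0.
    have [k|_ /eqP] := free0 (b 0 j) (- a 0 j); first by rewrite mulNr abC.
    by rewrite oppr_eq0 => /eqP.
  by have [//|/eqP] := free0 1 0; first by move=> j; rewrite a0 mulr0 mul0r addr0.
have minorF : (a 0 j * b 0 k - a 0 k * b 0 j)%:~R != 0 :> F.
  by rewrite intr_eq0_pchar0.
have xyj := xy j; have xyk := xy k.
split; apply: (mulIf minorF); rewrite mul0r rmorphB !rmorphM /=.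
  transitivity ((x * (a 0 j)%:~R + y * (b 0 j)%:~R) * (b 0 k)%:~R
    - (x * (a 0 k)%:~R + y * (b 0 k)%:~R) * (b 0 j)%:~R); first by ring.
  by rewrite xyj xyk !mul0r subr0.
transitivity ((x * (a 0 k)%:~R + y * (b 0 k)%:~R) * (a 0 j)%:~R
  - (x * (a 0 j)%:~R + y * (b 0 j)%:~R) * (a 0 k)%:~R); first by ring.
by rewrite xyj xyk !mul0r subr0.
Qed.

(** * Minimal generators of a positive semigroup *)

Section MinimalGenerators.
Variables (m n : nat) (h : 'I_n -> 'rV[int]_m).
Hypotheses (Hpos : positive_semigroup h) (Hmin : minimally_generating h).

Lemma generator_irredundant k : ~ semigroup h (predC1 k) (h k).
Proof.
case=> c hk; apply: (Hmin (k := k)) => a; split=> [[e ->]|[e ->]]; last first.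
  exists (fun j => if j == k then 0%N else e j).
  rewrite [RHS](bigD1 k) //= eqxx mulr0n add0r.
  by apply: eq_bigr => j /negPf->.
exists (fun j => e j + c j * e k)%N.
rewrite (bigD1 k) //= {1}hk -sumrMnl addrC -big_split /=.
by apply: eq_bigr => j _; rewrite mulrnDr mulrnA.
Qed.

(** Otherwise h_k = h_i + sum_j c_j h_j. If c_k = 0, then h_k is redundant. If c_k > 0, cancelling
    h_k shows that -h_i is in H, so h_i = 0 by positivity, and h_i is redundant. *)
Lemma generatorB_notin_semigroup i k : k != i -> ~ semigroup h predT (h k - h i).
Proof.
move=> ki [c /eqP]; have ik : i != k by rewrite eq_sym.
rewrite subr_eq (bigD1 k) //= => /eqP hk.
have [ck|ck] := posnP (c k).
  apply: (@generator_irredundant k); exists (fun j => c j + (j == i))%N.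
  rewrite {1}hk ck mulr0n add0r [RHS](bigD1 i) //= (bigD1 i) //=.
  rewrite eqxx mulrnDr mulr1n addrAC; congr (_ + _).
  by apply: eq_bigr => j /andP[_ /negPf->]; rewrite addn0.
have hi0 : h i = 0.
  apply: Hpos; first exact: semigroup_gen.
  exists (fun j => if j == k then (c k).-1 else c j).
  rewrite (bigD1 k) //= eqxx.
  under eq_bigr => j /negPf-> do [].
  apply/eqP; rewrite eq_sym -subr_eq0 opprK; move/eqP: hk.
  by rewrite -(prednK ck) mulrS -!addrA -{1}[h k]addr0 (inj_eq (addrI _)) eq_sym.
by apply: (@generator_irredundant i); exists (fun=> 0%N); rewrite hi0 big1.
Qed.

End MinimalGenerators.

(** * The linear form phi and the obstruction to extending it *)

Section Contraction.
Variables (K : fieldType) (m n : nat) (h : 'I_n -> 'rV[int]_m).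
Variables (i : 'I_n) (lam : 'cV[int]_n).
Local Notation R := (toric_ring K h).
Local Notation U := (diff_module K h).

(** The formula for phi on the whole free module. Its values are taken in the fraction field, as h_k
    - h_i need not lie in H. *)
Definition contract (u : 'rV[R]_n) : {fraction {mpoly K[m]}} :=
  \sum_k (lam k 0)%:~R * (val (u 0 k) * tmon K (h k - h i)).

Lemma contractP (x : R) u v :
  contract (x *: u + v) = val x * contract u + contract v.
Proof.
rewrite mulr_sumr -big_split; apply: eq_bigr => k _; rewrite !mxE.
by rewrite (rmorphD (val : R -> _)) (rmorphM (val : R -> _)) /=; ring.
Qed.

Lemma contract_sum (s : seq (R * 'rV[R]_n)) :
  contract (\sum_(x <- s) x.1 *: x.2) = \sum_(x <- s) val x.1 * contract x.2.
Proof.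
elim: s => [|x s IHs]; last by rewrite !big_cons contractP IHs.
by rewrite !big_nil /contract big1 // => k _; rewrite mxE rmorph0 mul0r mulr0.
Qed.

Lemma contract_diff_binom v : v \in rel_lattice h ->
  contract (diff_binom K h v) =
  ((v *m lam) 0 0)%:~R * tmon K (pos_degree h v - h i).
Proof.
move=> vL; rewrite mxE rmorph_sum mulr_suml; apply: eq_bigr => k _ /=.
rewrite diff_binomE // -mulrA -tmonD addrA subrK mulrA -intrM; congr (_%:~R * _).
by rewrite mulrC.
Qed.

Lemma contract_deg b u : freemod_deg b u ->
  exists c, contract u = const_frac m c * tmon K (- h i + b).
Proof.
move=> /choice[c ub]; exists (\sum_k (lam k 0)%:~R * c k).
rewrite rmorph_sum mulr_suml; apply: eq_bigr => k _ /=.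
rewrite ub -mulrA -tmonD addrA subrK mulrA rmorphM /= rmorph_int.
by rewrite [- _ + b]addrC.
Qed.

Hypothesis contract_toric : forall u,
  u \in @diff_pred K m n h -> contract u \in toric_pred h.

Definition contract_fun (u : U) : R^o := ToricRing (contract_toric (valP u)).

Fact contract_fun_is_linear : linear contract_fun.
Proof. by move=> x u v; apply: val_inj; rewrite /= contractP. Qed.
HB.instance Definition _ :=
  GRing.isLinear.Build R U R^o *:%R contract_fun contract_fun_is_linear.

Definition contract_dual : dual U := contract_fun.

Lemma contract_dual_deg : dual_deg (- h i) contract_dual.
Proof. by move=> b u /contract_deg[c e]; exists c. Qed.

(** Lift psi(dx_k) to a polynomial p_k and compare coefficients of phi(df_v) in degree h(v) - h_i.
    The k-th summand contributes the part of p_k of degree h_k - h_i: nothing for k <> i, as this is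
    not in H, and v(i) c for k = i, with c the degree 0 part of p_i. *)
Lemma contract_dual_restriction :
  positive_semigroup h -> minimally_generating h ->
  (exists psi, contract_dual = restriction psi) ->
  exists c : K, forall v, v \in rel_lattice h ->
    ((v *m lam) 0 0)%:~R = (v 0 i)%:~R * c.
Proof.
move=> Hpos Hmin [psi phi_psi].
have /choice[p pE] k : exists p, val (psi (delta_mx 0 k)) = toric_eval h p.
  by have /asboolP := valP (psi (delta_mx 0 k)).
have contractE v : v \in rel_lattice h -> contract (diff_binom K h v) =
    \sum_k val (diff_binom K h v 0 k) * toric_eval h (p k).
  move=> vL; have vU : diff_binom K h v \in @diff_pred K m n h.
    by apply/asboolP/generated_mem; exists v.
  have /(congr1 (fun f : dual U => val (f (DiffModule vU)))) := phi_psi.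
  have psiE : psi (diff_binom K h v) =
      \sum_k diff_binom K h v 0 k * psi (delta_mx 0 k) :> R.
    rewrite [in LHS](row_sum_delta (diff_binom K h v)) linear_sum.
    by apply: eq_bigr => k _; rewrite linearZ.
  rewrite [LHS]/= => ->; apply: etrans (congr1 (val : R -> _) psiE) _.
  rewrite (rmorph_sum (val : R -> _)).
  by apply: eq_bigr => k _; rewrite (rmorphM (val : R -> _)) -pE.
(* [N k] is the exponent of the product of all variables except x_k; it stands for t^{-h_k} after
   multiplication by t^s. *)
pose N k : 'X_{1..n} := [multinom (j != k : nat) | j < n].
pose s := \sum_j h j.
have NE k : lincomb h (zexp (N k)) = s - h k.
  rewrite /s (bigD1 k) //= addrAC subrr add0r [LHS](bigD1 k) //=.
  rewrite !mxE mnmE eqxx scale0r add0r; apply: eq_bigr => j jk.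
  by rewrite !mxE mnmE jk scale1r.
exists (coefsum (fun a => lincomb h (zexp (a + N i)%MM) == s - h i) (p i)) => v vL.
(* P lifts the relation for phi(df_v), multiplied by t^{s - h(v)}, to a polynomial in the kernel of
   the evaluation. *)
pose P := \sum_k (v 0 k)%:~R *: (p k * 'X_[N k]) - ((v *m lam) 0 0)%:~R *: 'X_[N i].
have : toric_eval h P = 0.
  apply: (mulfI (tmon_neq0 K (pos_degree h v - s))).
  rewrite mulr0 rmorphB rmorph_sum /= mulrBr toric_evalZ toric_evalX NE.
  rewrite rmorph_int mulrCA -tmonD addrA subrK.
  rewrite -contract_diff_binom // contractE // mulr_sumr -sumrB big1 // => k _.
  rewrite toric_evalZ rmorphM /= toric_evalX NE rmorph_int.
  rewrite diff_binomE // mulrCA [tmon _ _ * (_ * _)]mulrCA -tmonD addrA subrK.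
  by rewrite [toric_eval _ _ * _]mulrC mulrA subrr.
move/(toric_eval_eq0 (s - h i)); rewrite linearB linear_sum /=.
rewrite linearZ /= coefsumX NE eqxx mulr1 => /eqP; rewrite subr_eq0 => /eqP <-.
rewrite (bigD1 i) //= linearZ /= coefsumMX big1 ?addr0 // => k ki.
rewrite linearZ /= coefsumMX /coefsum big1 ?mulr0 // => a.
rewrite zexpD raddfD /= NE addrCA (inj_eq (addrI _)) => /eqP e; exfalso.
apply: (@generatorB_notin_semigroup _ _ _ Hpos Hmin i k ki).
have -> : h k - h i = lincomb h (zexp a) by rewrite -e addrCA subrr addr0.
exists (fun j => a j); apply: eq_bigr => j _.
by rewrite mxE -scaler_nat natz.
Qed.

End Contraction.


(** * Integrality: phi maps U to K[H] *)

Section SeparatedContraction.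
Variables (K : fieldType) (m n : nat) (h : 'I_n -> 'rV[int]_m) (i : 'I_n).
Variable L' : zmodClosed 'rV[int]_n.+1.
Hypothesis idL : forall p : {mpoly K[n]}, lattice_ideal (rel_lattice h) p <->
  exists2 q, lattice_ideal L' q & p = identify i q.
Variables (lam : 'cV[int]_n) (d : int).
Hypothesis lamL' : forall w, w \in L' ->
  (w *m identify_mx i *m lam) 0 0 = d * w 0 ord_max.

Lemma lincomb_eq (a b : 'X_{1..n}) : zexp a - zexp b \in rel_lattice h ->
  lincomb h (zexp a) = lincomb h (zexp b).
Proof. by move/eqP/eqP; rewrite raddfB subr_eq0 => /eqP. Qed.

Lemma pos_degreeE v : pos_degree h v = lincomb h (zexp (pos_part v)).
Proof.
rewrite /pos_degree big_mkcond; apply: eq_bigr => j _ /=.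
by rewrite mxE mnmE; case: ifP => [v0|_]; rewrite ?gez0_abs ?scale0r.
Qed.

Lemma tmonB_toric (a : 'X_{1..n}) : (0 < a i)%N ->
  tmon K (lincomb h (zexp a) - h i) \in toric_pred h.
Proof.
move=> a0; have -> : lincomb h (zexp a) - h i = lincomb h (zexp (a - U_(i))%MM).
  apply/eqP; rewrite subr_eq; apply/eqP.
  have {1}-> : a = (a - U_(i) + U_(i))%MM by rewrite submK // lep1mP -lt0n.
  rewrite zexpD raddfD /=; congr (_ + _); rewrite /lincomb (bigD1 i) //= !mxE.
  rewrite mnm1E eqxx scale1r big1 ?addr0 // => j; rewrite !mxE mnm1E eq_sym.
  by move=> /negPf->; rewrite scale0r.
by rewrite -toric_evalX toric_eval_toric.
Qed.

(* If w_(n+1) <> 0, then x_i divides one of the two monomials of the identified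
   binomial, both of which have the same degree. *)
Lemma toric_deriv_identify w : w \in L' ->
  tmon K (- h i) * toric_deriv h lam (identify i (lattice_binomial K w))
  \in toric_pred h.
Proof.
move=> wL'; rewrite identify_binomial.
have degE : lincomb h (zexp (identify_mnm i (pos_part w)))
    = lincomb h (zexp (identify_mnm i (pos_part (- w)))).
  by apply: lincomb_eq; rewrite identify_pos_partB (identify_mx_lattice idL).
rewrite toric_deriv_binomial // identify_pos_partB lamL' // mulrCA -tmonD addrC.
have [w0|w0|->] := ltrgtP (w 0 ord_max) 0; last by rewrite mulr0 mul0r rpred0.
  rewrite degE; apply: rpredM; first exact: rpred_int.
  apply: tmonB_toric; rewrite !mnmE eqxx mul1n !mxE !oppr_ge0 (ltW w0) !abszN.
  by rewrite addn_gt0 orbC absz_gt0 lt_eqF.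
apply: rpredM; first exact: rpred_int.
apply: tmonB_toric; rewrite !mnmE eqxx mul1n (ltW w0).
by rewrite addn_gt0 orbC absz_gt0 gt_eqF.
Qed.

(** Write f_v as a polynomial combination of the pi_i(f_w). These evaluate to 0, so by the Leibniz
    rule only their own derivatives remain, and [toric_deriv_identify] applies. *)
Lemma contract_binomial_toric v : v \in rel_lattice h ->
  contract i lam (diff_binom K h v) \in toric_pred h.
Proof.
move=> vL.
have degE : lincomb h (zexp (pos_part v)) = lincomb h (zexp (pos_part (- v))).
  by apply: lincomb_eq; rewrite pos_partB.
have -> : contract i lam (diff_binom K h v)
    = tmon K (- h i) * toric_deriv h lam (lattice_binomial K v).
  rewrite contract_diff_binom // lattice_binomialE toric_deriv_binomial // pos_partB.
  by rewrite mulrCA -tmonD pos_degreeE addrC.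
have /(lattice_ideal_identify idL) [s sL' e] :
    lattice_ideal (rel_lattice h) (lattice_binomial K v).
  by apply: generated_mem; exists v.
have -> : lattice_binomial K v = \sum_(x <- s) x.1 * x.2 :> {mpoly K[n]} by [].
rewrite raddf_sum mulr_sumr big_seq; apply: rpred_sum => x /sL' [w wL' xE] /=.
have x0 : toric_eval h x.2 = 0.
  rewrite xE identify_binomial rmorphB /= !toric_evalX; apply/eqP.
  rewrite subr_eq0; apply/eqP; congr tmon; apply: lincomb_eq.
  by rewrite identify_pos_partB; apply: (identify_mx_lattice idL).
rewrite toric_derivM x0 mul0r addr0 mulrCA rpredM ?toric_eval_toric //.
by rewrite xE toric_deriv_identify.
Qed.

Lemma contract_toric u : u \in @diff_pred K m n h -> contract i lam u \in toric_pred h.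
Proof.
move=> /asboolP[s sP ->]; rewrite contract_sum big_seq; apply: rpred_sum => x xs.
have [v vL ->] := sP x xs.
by rewrite rpredM ?contract_binomial_toric //; apply: valP.
Qed.

End SeparatedContraction.

(** * Nonvanishing of T^1 and inseparability *)

Lemma T1_separable (K : fieldType) (charK : [pchar K] =i pred0) (m n : nat)
    (h : 'I_n -> 'rV[int]_m)
    (Hpos : positive_semigroup h) (Hmin : minimally_generating h) (i : 'I_n) :
  separable_at K (rel_lattice h) i -> exists2 x : T1 K h, T1_deg (- h i) x & x != 0.
Proof.
case=> L' [_ [r rL' rL] idL [s [w [[wgen _] freew]]]].
(* Condition (iii) only places f_{w_j} in I_{L'}; that w_j lies in L' is recovered from the
   ideal. *)
have wL' j : w j \in L'.
  apply: (@lattice_binomial_ideal K); apply/wgen; by apply: generated_mem; exists j.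
have [lam [d [d0 lamL']]] := separating_functional idL rL' rL.
pose phi := contract_dual (contract_toric idL lamL').
exists (\pi_(T1 K h) phi)%qT.
  by exists phi => //; apply: contract_dual_deg.
apply/negP => /eqP e.
have : phi \in @restriction_image K m n h.
  rewrite -[phi]subr0 Quotient.idealrBE; apply/eqP.
  by rewrite e [LHS]piE.
move=> /asboolP /(contract_dual_restriction Hpos Hmin)[c cP].
(* Since p(w)(i) = w(i) + w(n+1), the equation d w(n+1) = c p(w)(i) is a relation between the two
   vectors of (iii). *)
have wE j : (d%:~R - c) * (w j 0 ord_max)%:~R
    + (- c) * (w j 0 (lift ord_max i))%:~R = 0 :> K.
  have := cP _ (identify_mx_lattice idL (wL' j)).
  rewrite lamL' // identify_mxE eqxx mul1r intrM intrD => E.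
  by rewrite mulrBl E; ring.
have [] := @row_free_pair s (\row_j w j 0 ord_max) (\row_j w j 0 (lift ord_max i)) K
  (d%:~R - c) (- c) charK.
- move: freew; congr (is_true (row_free (col_mx _ _))).
    by apply/rowP => j; rewrite !mxE.
  by apply/rowP => j; rewrite !mxE.
- by move=> j; rewrite !mxE wE.
move=> + /eqP; rewrite oppr_eq0 => + /eqP c0; rewrite c0 subr0 => /eqP.
by rewrite intr_eq0_pchar0 // (negPf d0).
Qed.

Theorem theorem4p3 (K : fieldType) (charK : [pchar K] =i pred0) (m n : nat)
    (h : 'I_n -> 'rV[int]_m)
    (Hpos : positive_semigroup h) (Hmin : minimally_generating h) :
  (forall i : 'I_n, separable_at K (rel_lattice h) i ->
     exists2 x : T1 K h, T1_deg (- h i) x & x != 0) /\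
  (forall l : {scalar 'rV[rat]_m}, standard_grading h l ->
     (forall x : T1 K h, T1_total_deg l (- 1) x -> x = 0) ->
     inseparable K (rel_lattice h)).
Proof.
split=> [i|l hl T1_0 i]; first exact: T1_separable.
(* The nonzero class in degree -h_i has total degree l(-h_i) = -1. *)
case/(T1_separable charK Hpos Hmin) => x xdeg /eqP; apply; apply: T1_0.
exists [:: x] => [y|]; last by rewrite big_seq1.
rewrite inE => /eqP->; exists (- h i); split=> //; last by rewrite map_mxN linearN hl.
exists (- delta_mx 0 i); rewrite raddfN /=; congr (- _).
rewrite /lincomb (bigD1 i) //= mxE !eqxx scale1r big1 ?addr0 // => j /negPf ji.
by rewrite mxE ji andbF scale0r.
Qed.
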